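(* Let $f$ be a multiplicative graph invariant, let $G$ be a graph and let $u$ be a vertex of $G$ of degree $d(u)$. Suppose that at least one of the following holds: (a) $f(G-u)>f(G)$ and $f(K_1)\geq 1$; (b) $f(G-u)=f(G)\neq 0$ and $f(K_1)\neq 1$; (c) $f(G-u)<f(G)$ and $f(K_1)\leq 1$. Then $es_f(G)\leq d(u)$.
   Context: All graphs are finite and simple (the graph with no vertices is allowed). An invariant is a function $f$ from graphs to $[0,\infty)$ that is constant on isomorphism classes. $f$ is multiplicative if $f(H_1\sqcup H_2)=f(H_1)\cdot f(H_2)$ for all disjoint graphs $H_1,H_2$, where $\sqcup$ is disjoint union. The $f$-edge stability number is $es_f(G)=\min\{|Y|: Y\subseteq E(G),\ f(G-Y)\neq f(G)\}$, and $es_f(G)=\infty$ if $f(G-Y)=f(G)$ for all $Y\subseteq E(G)$. *)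

(* Defs.v *)
From HB Require Import structures.
From mathcomp Require Import all_boot all_order all_algebra.
From mathcomp Require Import reals constructive_ereal.

Set Implicit Arguments.
Unset Strict Implicit.
Unset Printing Implicit Defensive.

Import Order.TTheory GRing.Theory Num.Theory.
Local Open Scope ring_scope.

Record graph := Graph {
  vertex :> finType;
  adj : rel vertex;
  adj_sym : symmetric adj;
  adj_irr : irreflexive adj }.

Definition isomorphic (G H : graph) : Prop :=
  exists2 phi : G -> H, bijective phi & forall x y, adj (phi x) (phi y) = adj x y.

Definition degree (G : graph) (u : G) : nat := #|[set v : G | adj u v]|.

Section CompleteGraph.
Variable n : nat.
Definition complete_adj : rel 'I_n := fun i j => i != j.
Lemma complete_sym : symmetric complete_adj.
Proof. by move=> i j; rewrite /complete_adj eq_sym. Qed.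
Lemma complete_irr : irreflexive complete_adj.
Proof. by move=> i; rewrite /complete_adj eqxx. Qed.
Definition complete : graph := Graph complete_sym complete_irr.
End CompleteGraph.

Section DisjointUnion.
Variables G H : graph.
Definition union_adj : rel (G + H)%type := fun a b =>
  match a, b with
  | inl x, inl y => adj x y
  | inr x, inr y => adj x y
  | _, _ => false
  end.
Lemma union_sym : symmetric union_adj.
Proof. by move=> [x|x] [y|y] //=; rewrite adj_sym. Qed.
Lemma union_irr : irreflexive union_adj.
Proof. by move=> [x|x] /=; rewrite adj_irr. Qed.
Definition disjoint_union : graph := Graph union_sym union_irr.
End DisjointUnion.

Section DeleteVertex.
Variables (G : graph) (u : G).
Definition del_vertex_adj : rel {x : G | x != u} := fun x y => adj (val x) (val y).
Lemma del_vertex_sym : symmetric del_vertex_adj.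
Proof. by move=> x y; rewrite /del_vertex_adj adj_sym. Qed.
Lemma del_vertex_irr : irreflexive del_vertex_adj.
Proof. by move=> x; rewrite /del_vertex_adj adj_irr. Qed.
Definition del_vertex : graph := Graph del_vertex_sym del_vertex_irr.
End DeleteVertex.

Definition edges (G : graph) : {set {set G}} :=
  [set [set p.1; p.2] | p : G * G & adj p.1 p.2].

Section DeleteEdges.
Variables (G : graph) (Y : {set {set G}}).
Definition del_edges_adj : rel G := fun x y => adj x y && ([set x; y] \notin Y).
Lemma del_edges_sym : symmetric del_edges_adj.
Proof. by move=> x y; rewrite /del_edges_adj adj_sym setUC. Qed.
Lemma del_edges_irr : irreflexive del_edges_adj.
Proof. by move=> x; rewrite /del_edges_adj adj_irr. Qed.
Definition del_edges : graph := Graph del_edges_sym del_edges_irr.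
End DeleteEdges.

Section Invariants.
Variables (R : realType) (f : graph -> R).

Definition graph_invariant : Prop :=
  (forall G, 0 <= f G) /\ (forall G H, isomorphic G H -> f G = f H).

(* For an invariant it is enough to consider the tagged union, to which the
   union of any two vertex-disjoint graphs is isomorphic. *)
Definition multiplicative_invariant : Prop :=
  forall G H, f (disjoint_union G H) = f G * f H.

(* Finite minimum; it is +oo when no admissible set [Y] exists. *)
Definition edge_stability (G : graph) : \bar R :=
  \big[Order.min/+oo%E]_(Y : {set {set G}}
      | (Y \subset edges G) && (f (del_edges Y) != f G)) (#|Y|%:R)%:E.
End Invariants.

(* Main.v *)
Require Import Defs.
From HB Require Import structures.
From mathcomp Require Import all_boot all_order all_algebra.
From mathcomp Require Import reals constructive_ereal.
Import Order.TTheory GRing.Theory Num.Theory.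
Local Open Scope ring_scope.

(** Deleting the [d(u)] edges at [u] leaves the disjoint union of [G - u] and
    [K_1], on which [f] takes the value [f(G - u) * f(K_1)]; each of (a), (b),
    (c) makes this product different from [f(G)]. *)

Definition star (G : graph) (u : G) : {set {set G}} :=
  [set [set u; v] | v in [set v : G | adj u v]].

Lemma star_sub_edges (G : graph) (u : G) : star G u \subset edges G.
Proof.
apply/subsetP => _ /imsetP[v /[!inE] uv ->].
by apply/imsetP; exists (u, v); rewrite ?inE.
Qed.

Lemma card_star (G : graph) (u : G) : (#|star G u| <= degree u)%N.
Proof. exact: leq_imset_card. Qed.

(** Once the pair is known to be an edge, lying in the star only depends on whether [u] is an
    endpoint. *)
Lemma mem_star (G : graph) (u x y : G) :
  adj x y -> ([set x; y] \in star G u) = (x == u) || (y == u).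
Proof.
move=> xy; apply/imsetP/idP => [[v _ xyE]|].
  have: u \in [set x; y] by rewrite xyE set21.
  by rewrite in_set2 !(eq_sym u).
(* The endpoint other than [u] is the neighbour that witnesses membership. *)
case/orP=> /eqP uE; rewrite -uE.
  by exists y; rewrite ?inE.
by exists x; rewrite 1?setUC // inE adj_sym.
Qed.

(** The vertices other than [u] keep their mutual edges, while [u] becomes isolated and serves as
    the vertex of [K_1]. *)
Lemma del_star_isomorphic (G : graph) (u : G) :
  isomorphic (disjoint_union (del_vertex u) (complete 1))
             (del_edges (star G u)).
Proof.
pose phi (a : disjoint_union (del_vertex u) (complete 1)) :
    del_edges (star G u) := match a with inl x => val x | inr _ => u end.
pose psi (x : del_edges (star G u)) :
    disjoint_union (del_vertex u) (complete 1) :=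
  (* [insub] fails exactly at [x = u]. *)
  if insub x is Some x' then inl x' else inr ord0.
exists phi.
  exists psi => [[x|i]|x]; rewrite /psi /phi.
  - by rewrite valK.
  - by rewrite insubF ?eqxx // (ord1 i).
  - by case: insubP => [x' _ ->|/negPn/eqP].
move=> [x|i] [y|j]; rewrite /= /del_edges_adj /=.
(* An edge of [G] survives exactly when both ends come from [G - u]; the mixed cases are the deleted
   edges. *)
- rewrite /del_vertex_adj; case xy: (adj _ _) => //=.
  by rewrite mem_star // (negPf (valP x)) (negPf (valP y)).
- by case xu: (adj _ _) => //=; rewrite mem_star // eqxx orbT.
- by case uy: (adj _ _) => //=; rewrite mem_star // eqxx.
- by rewrite adj_irr /complete_adj (ord1 i) (ord1 j) eqxx.
Qed.

Lemma edge_stability_le (R : realType) (f : graph -> R) (G : graph)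
    (Y : {set {set G}}) :
  Y \subset edges G -> f (del_edges Y) != f G ->
  (edge_stability f G <= (#|Y|%:R)%:E)%E.
Proof.
move=> YG fY.
by apply: (bigmin_le_cond _ (fun Z : {set {set G}} => (#|Z|%:R)%:E));
  rewrite YG.
Qed.

Theorem theorem3p1 (R : realType) (f : graph -> R)
    (finv : graph_invariant f) (fmul : multiplicative_invariant f) (G : graph) (u : G)
    (habc : (f (del_vertex u) > f G /\ f (complete 1) >= 1) \/
            (f (del_vertex u) = f G /\ f G <> 0 /\ f (complete 1) <> 1) \/
            (f (del_vertex u) < f G /\ f (complete 1) <= 1)) :
  (edge_stability f G <= (degree u)%:R%:E)%E.
Proof.
have [f_ge0 f_iso] := finv.
have fE : f (del_edges (star G u)) = f (del_vertex u) * f (complete 1).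
  by rewrite -fmul; symmetry; apply/f_iso/del_star_isomorphic.
apply: (@le_trans _ _ (#|star G u|%:R)%:E); last first.
  by rewrite lee_fin ler_nat card_star.
apply: edge_stability_le; first exact: star_sub_edges.
rewrite fE; case: habc => [[fu k1]|[[fu [fG k1]]|[fu k1]]].
(* (a): [f(G) < f(G-u) <= f(G-u) * f(K_1)], the second step by [f(G-u) >= 0]. *)
- by rewrite gt_eqF // (lt_le_trans fu) // ler_peMr.
(* (b): cancelling [f(G) != 0] in [f(G) * f(K_1) = f(G) * 1] would force [f(K_1) = 1]. *)
- apply/eqP; rewrite fu -[RHS]mulr1 => /(mulfI _) k1E.
  by apply/k1/k1E/eqP.
(* (c): [f(G-u) * f(K_1) <= f(G-u) < f(G)], again by nonnegativity. *)
- by rewrite lt_eqF // (le_lt_trans _ fu) // ler_piMr.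
Qed.
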